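(* The set of possible values of $|A^*|$, where $A$ ranges over all rings with finite group of units, consists exactly of all the even positive integers together with all the finite products of integers of the form $2^\lambda-1$ with $\lambda\ge 1$.
   Context: Rings are commutative with $1\ne0$, of arbitrary characteristic. $A^*$ denotes the multiplicative group of invertible elements of $A$. *)

(* Defs.v *)
From mathcomp Require Import all_boot all_algebra.
From mathcomp Require Import boolp classical_sets functions cardinality.

Local Open Scope classical_set_scope.

(* Classically every comNzRingType carries the comUnitRingType structure whose
   boolean predicate GRing.unit holds exactly of the invertible elements. *)
Definition units (A : comUnitRingType) : set A :=
  [set x | x \is a GRing.unit].

(* The set A^* is finite with exactly n elements; `I_n is {0, ..., n-1}. *)
Definition has_n_units (A : comUnitRingType) (n : nat) : Prop :=
  (units A #= `I_n)%card.

Definition unit_group_cardinals : set nat :=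
  [set n | exists A : comUnitRingType, has_n_units A n].

Definition even_positive : set nat := [set n | (0 < n)%N /\ ~~ odd n].

Definition mersenne_products : set nat :=
  [set n | exists2 s : seq nat,
     (forall l, l \in s -> (1 <= l)%N) & n = (\prod_(l <- s) (2 ^ l - 1))%N].

(* Main.v *)
From HB Require Import structures.
Require Import Defs.
From mathcomp Require Import all_boot all_fingroup all_algebra all_solvable.
From mathcomp Require Import all_field finmap.
From mathcomp Require Import boolp classical_sets functions cardinality.

(** Let A be a ring with an odd number n of units.  By Lagrange no unit has
order two, which is applied twice: to -1, so that A has characteristic two, and
to 1 + x with x ^ 2 = 0, so that A is reduced ([odd_units_char2],
[odd_units_reduced]).  The set B of all sums of finitely many units is then a
finite reduced subring of A with the same units as A.  Such a ring is a product
of finite fields of characteristic two, hence n is a product of numbers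
2 ^ l - 1.

The decomposition of B into fields is not constructed; only units are counted.
For an idempotent e, the corner eB is a ring with identity e.  Either all its
nonzero elements are invertible, and it has 2 ^ k - 1 units, or it contains a
nonzero noninvertible x; some power f of x is then an idempotent other than 0
and e, and eB is the product of the smaller corners fB and (e - f)B.  Induction
on the size of the corner concludes ([card_corner_units_mersenne]).

Conversely, the units of the extension of the integers by a square-zero ideal M
are the pairs (1, x) and (-1, x), so that M = Z/m realises 2m, and a product of
the fields with 2 ^ l elements realises a product of numbers 2 ^ l - 1. *)

Set Implicit Arguments.
Unset Strict Implicit.
Unset Printing Implicit Defensive.

Import GRing.Theory.

Local Open Scope classical_set_scope.
Local Open Scope ring_scope.

(** * Products of Mersenne numbers *)

Lemma mersenne_products1 : mersenne_products 1.
Proof. by exists [::]; rewrite ?big_nil. Qed.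

Lemma mersenne_productsM m n :
  mersenne_products m -> mersenne_products n -> mersenne_products (m * n)%N.
Proof.
move=> [s s_gt0 ->] [t t_gt0 ->]; exists (s ++ t); last by rewrite big_cat.
by move=> l; rewrite mem_cat => /orP[/s_gt0|/t_gt0].
Qed.

Lemma mersenne_products_pow2 k :
  (0 < k)%N -> mersenne_products (2 ^ k - 1)%N.
Proof.
move=> k_gt0; exists [:: k]; last by rewrite big_seq1.
by move=> l; rewrite inE => /eqP->.
Qed.

(** * Counting units with lists *)

(** Duplicate-free lists are the form in which the units are summed, multiplied
and counted below. *)
Lemma has_n_unitsP (A : comUnitRingType) n :
  has_n_units A n <->
  exists s : seq A,
    [/\ uniq s, size s = n & forall x, (x \in s) = (x \is a GRing.unit)].
Proof.
split=> [An|[s [s_uniq s_size s_mem]]].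
  have /finite_fsetP[X AX] : finite_set (units A) by exists n.
  exists (enum_fset X); split; first exact: fset_uniq.
    by apply/card_eq_fsetP; rewrite -AX.
  move=> x; apply/idP/idP => xs.
    by have: [set` X] x; [by []|rewrite -AX].
  by have: [set` X] x; first by rewrite -AX.
suff s_units : units A = [set` seq_fset tt s].
  rewrite /has_n_units s_units; apply/card_eq_fsetP.
  by rewrite size_seq_fset undup_id.
by apply/seteqP; split=> x; rewrite /units /mkset seq_fsetE s_mem.
Qed.

Lemma has_n_units_bij (T : finType) (A : comUnitRingType) (f : T -> A) :
  injective f -> (forall x, (x \is a GRing.unit) <-> (exists t, f t = x)) ->
  has_n_units A #|T|.
Proof.
move=> f_inj f_unit; apply/has_n_unitsP; exists (codom f); split.
- by rewrite map_inj_uniq ?enum_uniq.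
- by rewrite size_codom.
move=> x; apply/codomP/idP => [[t ->]|]; first by apply/f_unit; exists t.
by move/f_unit=> [t <-]; exists t.
Qed.

Lemma has_n_units_prod (A B : comUnitRingType) m n :
  has_n_units A m -> has_n_units B n -> has_n_units (A * B)%type (m * n)%N.
Proof.
move=> /has_n_unitsP[s [s_uniq <- s_mem]] /has_n_unitsP[t [t_uniq <- t_mem]].
apply/has_n_unitsP; exists [seq (x, y) | x <- s, y <- t].
split; first by apply: allpairs_uniq => // -[? ?] [? ?].
  by rewrite size_allpairs.
move=> [x y]; apply/allpairsP/idP => /= [[[u v] /= [us vt [-> ->]]]|].
  by apply/andP; rewrite /= -s_mem -t_mem.
by case/andP; rewrite /= -s_mem -t_mem => xs yt; exists (x, y).
Qed.

(** * Realising the even numbers *)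

Section TrivialExtension.

Variable M : zmodType.

(** The square-zero extension of the integers by M, in which 0 x M is an ideal
with zero product. *)
Definition trivial_extension : Type := (int * M)%type.

HB.instance Definition _ := GRing.Zmodule.on trivial_extension.

Implicit Types x y z : trivial_extension.

Let one : trivial_extension := (1, 0).
Let mul x y : trivial_extension := (x.1 * y.1, y.2 *~ x.1 + x.2 *~ y.1).

Let mulA : associative mul.
Proof.
move=> [a x] [b y] [c z]; congr pair; rewrite /= ?mulrA //.
by rewrite !mulrzDl -!mulrzA addrA [b * a]mulrC [c * a]mulrC.
Qed.

Let mulC : commutative mul.
Proof. by move=> [a x] [b y]; congr pair; rewrite /= 1?mulrC 1?addrC. Qed.

Let mul1 : left_id one mul.
Proof. by move=> [a x]; congr pair; rewrite /= ?mul1r // mul0rz addr0. Qed.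

Let mulDl : left_distributive mul +%R.
Proof.
move=> [a x] [b y] [c z]; congr pair; rewrite /= ?mulrDl //.
by rewrite mulrzDr mulrzDl addrACA.
Qed.

Let one_neq0 : one != 0.
Proof. by []. Qed.

HB.instance Definition _ :=
  GRing.Zmodule_isComNzRing.Build trivial_extension
    mulA mulC mul1 mulDl one_neq0.

Let unit : {pred trivial_extension} := fun x => x.1 \is a GRing.unit.
Let inv x : trivial_extension := if x \in unit then (x.1, - x.2) else x.

Let mulVx : {in unit, left_inverse 1 inv *%R}.
Proof.
move=> [a x] ax_unit; rewrite /inv ax_unit; congr pair => /=.
  by case/orP: ax_unit => /eqP /= ->.
by rewrite mulNrz subrr.
Qed.

Let unitPl x y : y * x = 1 -> unit x.
Proof. by case=> xy _; apply/unitrPr; exists y.1; rewrite mulrC. Qed.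

Let inv_out : {in [predC unit], inv =1 id}.
Proof. by move=> x; rewrite inE /inv => /negbTE ->. Qed.

HB.instance Definition _ :=
  GRing.ComNzRing_hasMulInverse.Build trivial_extension mulVx unitPl inv_out.

Lemma unit_trivial_extensionE x :
  (x \is a GRing.unit) = (x.1 \is a GRing.unit).
Proof. by []. Qed.

End TrivialExtension.

(** Since (1, x) (1, y) = (1, x + y), the unit group is the product of the group
of order two and of the additive group M. *)
Lemma has_n_units_trivial_extension (M : finZmodType) :
  has_n_units (trivial_extension M) (2 * #|M|).
Proof.
rewrite -card_bool -card_prod.
pose f (p : bool * M) : trivial_extension M := ((-1) ^+ p.1, p.2).
apply: (@has_n_units_bij _ _ f); first by move=> [[] x] [[] y] [] // ->.
move=> [a x]; rewrite unit_trivial_extensionE; split.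
  by case/orP => /eqP /= ->; [exists (false, x)|exists (true, x)].
by case=> -[[] y] [<- _].
Qed.

Lemma even_unit_group_cardinal n :
  (0 < n)%N -> ~~ odd n -> unit_group_cardinals n.
Proof.
move=> n_gt0 n_even; have -> : n = (2 * n./2.-1.+1)%N.
  rewrite mul2n prednK ?even_halfK // half_gt0.
  by case: n n_gt0 n_even => [|[]].
exists (trivial_extension 'I_(n./2.-1.+1)).
by rewrite -[X in (2 * X)%N]card_ord; apply: has_n_units_trivial_extension.
Qed.

(** * Realising the products of Mersenne numbers *)

Lemma has_n_units_finField (F : finFieldType) : has_n_units F #|F|.-1.
Proof.
apply/has_n_unitsP; exists (enum [pred x : F | x != 0]); split.
- exact: enum_uniq.
- by rewrite -cardE cardC1.
- by move=> x; rewrite mem_enum inE unitfE.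
Qed.

Lemma pow2_unit_group_cardinal l :
  (0 < l)%N -> unit_group_cardinals (2 ^ l - 1)%N.
Proof.
move=> l_gt0; have [//|F _ F_card] := @pPrimePowerField 2 l isT.
by exists F; rewrite -F_card subn1; apply: has_n_units_finField.
Qed.

Lemma unit_group_cardinalsM m n :
  unit_group_cardinals m -> unit_group_cardinals n ->
  unit_group_cardinals (m * n)%N.
Proof.
by move=> [A Am] [B Bn]; exists (A * B)%type; apply: has_n_units_prod.
Qed.

Lemma mersenne_unit_group_cardinal n :
  mersenne_products n -> unit_group_cardinals n.
Proof.
move=> [s s_gt0 ->]; elim: s s_gt0 => [|l s IHs] s_gt0.
  (* The empty product is realised by the field with two elements. *)
  by rewrite big_nil; apply: (@pow2_unit_group_cardinal 1).
rewrite big_cons; apply: unit_group_cardinalsM.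
  by apply: pow2_unit_group_cardinal; apply: s_gt0; rewrite mem_head.
by apply: IHs => k ks; apply: s_gt0; rewrite inE ks orbT.
Qed.

(** * Units of finite reduced rings of characteristic two *)

(** The powers of x are eventually periodic; if the period is d, any exponent
that is a multiple of d and lies in the periodic range gives an idempotent. *)
Lemma idempotent_power (R : finNzRingType) (x : R) :
  exists2 m, (0 < m)%N & x ^+ m * x ^+ m = x ^+ m.
Proof.
pose f (i : 'I_#|R|.+1) := x ^+ i.
have /injectivePn[i [j ij fij]] : ~~ injectiveb f.
  apply/negP => /injectiveP/leq_card.
  by rewrite card_ord ltnn.
wlog lt_ij : i j ij fij / (i < j)%N => [wl|].
  have [lt_ij|lt_ji|/val_inj eq_ij] := ltngtP i j; first exact: (wl i j).
    by apply: (wl j i) => //; rewrite eq_sym.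
  by rewrite eq_ij eqxx in ij.
pose d := (j - i)%N.
have step m t : (i <= m)%N -> x ^+ (m + d * t) = x ^+ m.
  move=> le_im; elim: t => [|t <-]; first by rewrite muln0 addn0.
  rewrite mulnS addnCA -[(m + _)%N](subnKC (leq_trans le_im (leq_addr _ _))).
  by rewrite addnA subnK 1?ltnW // 2!exprD -/(f j) -fij.
have d_gt0 : (0 < d)%N by rewrite subn_gt0.
exists (d * i.+1)%N; first by rewrite muln_gt0 d_gt0.
rewrite -exprD step // (leq_trans (leqnSn i)) //.
by rewrite leq_pmull.
Qed.

Section Corners.

Variable R : finComNzRingType.
Implicit Types e f x y : R.

Definition corner e : {set R} := [set x | e * x == x].

(** Any y with x * y = e witnesses that x is invertible in the corner, because
e * y is then an inverse of x that lies in the corner. *)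
Definition corner_units e : {set R} :=
  [set x in corner e | [exists y, x * y == e]].

Lemma corner_unitsP e x :
  reflect (e * x = x /\ exists y, x * y = e) (x \in corner_units e).
Proof.
rewrite !inE; apply: (iffP andP) => [[/eqP-> /existsP[y /eqP xy]]|[-> [y xy]]].
  by split=> //; exists y.
by split=> //; apply/existsP; exists y; apply/eqP.
Qed.

(** The additive group of a corner is an elementary abelian 2-group. *)
Lemma card_corner_pow2 e :
  1 + 1 = 0 :> R -> exists k, #|corner e| = (2 ^ k)%N.
Proof.
move=> char2; have grp : group_set (corner e : {set R}).
  apply/group_setP; split=> [|x y]; first by rewrite inE mulr0.
  by rewrite !inE FinRing.Theory.zmodMgE mulrDr => /eqP-> /eqP->.
have : (2.-abelem (Group grp))%g.
  apply/abelemP => //; split=> [|x _]; first exact: FinRing.Theory.zmod_abelian.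
  by rewrite FinRing.Theory.zmodXgE mulr2n -[x]mul1r -mulrDl char2 mul0r.
by move=> /abelem_pgroup/p_natP[k]; exists k.
Qed.

Section Splitting.

Variables e f : R.
Hypotheses (ee : e * e = e) (ff : f * f = f) (ef : e * f = f).

Let fe : f * e = f. Proof. by rewrite mulrC. Qed.

Lemma idempotentB : (e - f) * (e - f) = e - f.
Proof. by rewrite mulrBr !mulrBl ee ef fe ff subrr subr0. Qed.

Lemma idempotentBM : e * (e - f) = e - f.
Proof. by rewrite mulrBr ee ef. Qed.

(** The idempotents f and e - f are orthogonal with sum e, so that addition
identifies fR x (e - f)R with eR, and the units with the pairs of units. *)
Lemma card_corner_units_split :
  #|corner_units e| = (#|corner_units f| * #|corner_units (e - f)%R|)%N.
Proof.
have fg : f * (e - f) = 0 by rewrite mulrBr ff fe subrr.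
have gf : (e - f) * f = 0 by rewrite mulrC.
rewrite -cardsX -[RHS](card_in_imset (f := fun p => p.1 + p.2)); last first.
  move=> [x y] [x' y'] /setXP[/= /corner_unitsP[fx _] /corner_unitsP[gy _]].
  move=> /setXP[/= /corner_unitsP[fx' _] /corner_unitsP[gy' _]] eq_sum.
  have := congr1 ( *%R f) eq_sum; have := congr1 ( *%R (e - f)) eq_sum.
  rewrite -fx -fx' -gy -gy' !mulrDr ![(e - f) * (f * _)]mulrA !mulrA.
  by rewrite fg gf ff idempotentB !mul0r !addr0 !add0r => -> ->.
congr #|pred_of_set _|; apply/finset.setP => x; apply/corner_unitsP/imsetP.
  move=> [ex [y xy]]; exists (f * x, (e - f) * x).
    apply/setXP; split; apply/corner_unitsP => /=; split.
    - by rewrite mulrA ff.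
    - by exists y; rewrite -mulrA xy fe.
    - by rewrite mulrA idempotentB.
    - by exists y; rewrite -mulrA xy mulrC idempotentBM.
  by rewrite -mulrDl addrC subrK ex.
case=> [[y z] /setXP[/= /corner_unitsP[fy [y' yy']]]].
move=> /corner_unitsP[gz [z' zz']] ->.
split; first by rewrite -fy -gz mulrDr !mulrA ef idempotentBM.
(* The inverses are projected to their corners to kill the cross terms. *)
exists (f * y' + (e - f) * z'); rewrite mulrDr.
rewrite [X in X + _]mulrDl [X in _ + X]mulrDl.
have -> : z * (f * y') = 0 by rewrite -gz mulrACA gf mul0r.
have -> : y * ((e - f) * z') = 0 by rewrite -fy mulrACA fg mul0r.
rewrite addr0 add0r [y * _]mulrCA yy' ff [z * _]mulrCA zz' idempotentB.
by rewrite addrC subrK.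
Qed.

Lemma corner_proper : f != e -> corner f \proper corner e.
Proof.
move=> f_neq_e; apply/properP; split.
  by apply/fintype.subsetP => x; rewrite !inE => /eqP fx; rewrite -fx mulrA ef.
by exists e; rewrite !inE ?ee ?fe //.
Qed.

End Splitting.

Hypothesis char2 : 1 + 1 = 0 :> R.
Hypothesis reduced : forall x, x * x = 0 -> x = 0.

Lemma nilpotent_eq0 x m : x ^+ m = 0 -> x = 0.
Proof.
elim: m => [/eqP|[//|m IHm xm]]; first by rewrite expr0 oner_eq0.
by apply/IHm/reduced; rewrite -exprD addSnnS exprD xm mulr0.
Qed.

(** Reducedness ensures that the idempotent power of a nonzero element of the
corner is nonzero, so that the complementary corner is strictly smaller. *)
Lemma card_corner_units_mersenne e :
  e * e = e -> mersenne_products #|corner_units e|.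
Proof.
have [n] := ubnP #|corner e|; elim: n e => // n IHn e corner_lt ee.
have [all_units|] :=
  boolP [forall x in corner e, (x != 0) ==> (x \in corner_units e)].
  have [e0|e_neq0] := eqVneq e 0.
    (* In the zero ring the only element, 0, counts as a unit. *)
    suff -> : corner_units e = [set 0]%SET.
      by rewrite cards1; apply: mersenne_products1.
    apply/finset.setP => x; rewrite finset.in_set1.
    apply/corner_unitsP/eqP => [[]|->].
      by rewrite e0 mul0r => <-.
    by rewrite e0 mul0r; split=> //; exists 0; rewrite mul0r.
  have [k corner_card] := card_corner_pow2 e char2.
  have -> : corner_units e = corner e :\ 0.
    apply/finset.setP => x; rewrite finset.in_setD1.
    apply/idP/andP => [xu|[x0 xe]].
      have [ex [y xy]] := corner_unitsP _ _ xu; rewrite inE ex eqxx; split=> //.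
      by apply: contraNneq e_neq0 => x0; rewrite -xy x0 mul0r.
    by move: all_units => /forallP/(_ x); rewrite xe x0.
  have corner0 : 0 \in corner e by rewrite inE mulr0.
  have nonzero_gt0 : (0 < #|corner e :\ 0%R|)%N.
    by apply/card_gt0P; exists e; rewrite finset.in_setD1 e_neq0 inE ee eqxx.
  have := cardsD1 0 (corner e); rewrite corner0 corner_card add1n => pow2E.
  rewrite -[X in mersenne_products X]succnK -pow2E -subn1.
  apply: mersenne_products_pow2; case: k pow2E {corner_card} => // -[card0].
  by rewrite -card0 in nonzero_gt0.
rewrite negb_forall => /existsP[x].
rewrite !negb_imply => /and3P[xe x_neq0 x_nunit].
have [m m_gt0 ff] := idempotent_power x; set f := x ^+ m in ff.
have ex : e * x = x by apply/eqP; rewrite inE in xe.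
have ef : e * f = f by rewrite /f -(prednK m_gt0) exprS mulrA ex.
have f_neq0 : f != 0 by apply: contraNneq x_neq0 => /nilpotent_eq0 ->.
have f_neq_e : f != e.
  apply: contraNneq x_nunit => fe; apply/corner_unitsP; split=> //.
  by exists (x ^+ m.-1); rewrite -exprS prednK.
rewrite (card_corner_units_split ee ff ef).
have smaller g : corner g \proper corner e -> (#|corner g| < n)%N.
  by move=> /proper_card/leq_trans; apply.
apply: mersenne_productsM; apply: IHn => //.
- exact/smaller/corner_proper.
- apply/smaller/corner_proper => //; first exact: idempotentBM.
  by rewrite -subr_eq0 addrAC subrr sub0r oppr_eq0.
- exact: idempotentB.
Qed.

End Corners.

(** * The subring generated by finitely many units *)

Section SubsetSums.

Variable A : comNzRingType.
Implicit Types (s : seq A) (u x y : A).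

(** The sums of all sublists of s; in characteristic two they form the additive
group generated by s, because multiplicities only matter modulo two. *)
Definition subset_sums s : seq A :=
  foldr (fun u t => t ++ [seq u + x | x <- t]) [:: 0] s.

Lemma subset_sums_consP u s x :
  reflect (x \in subset_sums s \/ exists2 y, y \in subset_sums s & x = u + y)
          (x \in subset_sums (u :: s)).
Proof.
rewrite /= mem_cat; apply: (iffP orP) => -[|]; try by left.
  by move=> /mapP[y ys ->]; right; exists y.
by move=> [y ys ->]; right; apply/mapP; exists y.
Qed.

Lemma subset_sums0 s : 0 \in subset_sums s.
Proof. by elim: s => [|u s IHs]; rewrite ?inE //= mem_cat IHs. Qed.

Lemma sub_subset_sums s : {subset s <= subset_sums s}.
Proof.
elim: s => // u s IHs x; rewrite inE => /predU1P[->|/IHs xs];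
  apply/subset_sums_consP.
  by right; exists 0; rewrite ?subset_sums0 ?addr0.
by left.
Qed.

Lemma subset_sums_ind s (P : A -> Prop) :
  P 0 -> (forall u x, u \in s -> P x -> P (u + x)) ->
  forall x, x \in subset_sums s -> P x.
Proof.
move=> P0; elim: s => [|u s IHs] PD x; first by rewrite inE => /eqP->.
have {}IHs : forall y, y \in subset_sums s -> P y.
  by apply: IHs => v y vs; apply: PD; rewrite inE vs orbT.
case/subset_sums_consP => [/IHs //|[y /IHs Py ->]].
by apply: PD; rewrite ?mem_head.
Qed.

Hypothesis char2 : 1 + 1 = 0 :> A.

Lemma char2_addrr x : x + x = 0.
Proof. by rewrite -[x]mul1r -mulrDl char2 mul0r. Qed.

Lemma subset_sumsD s :
  {in subset_sums s &, forall x y, x + y \in subset_sums s}.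
Proof.
elim: s => [|u s IHs] x y.
  by rewrite !inE => /eqP-> /eqP->; rewrite addr0.
case/subset_sums_consP=> [xs|[{}x xs ->]] /subset_sums_consP[ys|[{}y ys ->]];
  apply/subset_sums_consP.
- by left; apply: IHs.
- by right; exists (x + y); rewrite ?IHs // addrCA.
- by right; exists (x + y); rewrite ?IHs // addrA.
- by left; rewrite addrACA char2_addrr add0r IHs.
Qed.

(** Products of sums expand into sums of products of elements of s, and
opposites are trivial in characteristic two. *)
Lemma subset_sums_subring s :
  1 \in s -> {in s &, forall u v, u * v \in s} ->
  subring_closed (fun x => x \in subset_sums s).
Proof.
move=> s1 sM; split=> [|x y|x y]; rewrite -?topredE /=.
- exact: sub_subset_sums.
- have -> : - y = y by apply/eqP; rewrite eq_sym -addr_eq0 char2_addrr.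
  exact: subset_sumsD.
move=> xs; move: y; apply: subset_sums_ind => [|v y vs xys].
  by rewrite mulr0 subset_sums0.
rewrite mulrDr subset_sumsD // => {xys}; move: x xs.
apply: subset_sums_ind => [|u x us xvs]; first by rewrite mul0r subset_sums0.
by rewrite mulrDl subset_sumsD // sub_subset_sums // sM.
Qed.

End SubsetSums.

Section FiniteSubring.

Variables (A : comNzRingType) (s : seq A).

(** The type of the elements of s is indexed by the proof that s is a subring,
so that it can carry a canonical ring structure. *)
Definition finite_subring of subring_closed (fun x => x \in s) : Type :=
  seq_sub s.

Variable s_closed : subring_closed (fun x => x \in s).

HB.instance Definition _ :=
  SubFinite.copy (finite_subring s_closed) (seq_sub s).
HB.instance Definition _ :=
  GRing.SubChoice_isSubComNzRing.Build A (fun x => x \in s)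
    (finite_subring s_closed) s_closed.

End FiniteSubring.

(** * Rings with an odd number of units *)

Section OddUnits.

Variables (A : comUnitRingType) (s : seq A).
Hypotheses (s_uniq : uniq s) (s_odd : odd (size s)).
Hypothesis s_units : forall x, (x \in s) = (x \is a GRing.unit).

(** Lagrange for the unit group: multiplication by u permutes the units, and
comparing their products gives u ^ n = 1, where n is odd. *)
Lemma odd_units_involution (u : A) : u * u = 1 -> u = 1.
Proof.
move=> uu; have u_unit : u \is a GRing.unit by apply/unitrPr; exists u.
pose P : A := \prod_(v <- s) v.
have P_unit : P \is a GRing.unit.
  by rewrite /P big_seq; apply: rpred_prod => v; rewrite s_units.
have s_perm : perm_eq s [seq u * v | v <- s].
  apply: uniq_perm => //; first by rewrite map_inj_uniq //; apply: mulrI.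
  move=> x; rewrite s_units; apply/idP/mapP => [x_unit|[v vs ->]].
    by exists (u * x); rewrite ?s_units ?unitrM ?u_unit // mulrA uu mul1r.
  by rewrite unitrM u_unit -s_units.
have : u * P = 1 * P.
  rewrite mul1r {2}/P (perm_big _ s_perm) big_map big_split /= big_const_seq.
  rewrite count_predT iter_mulr mulr1 -(odd_double_half (size s)) s_odd exprS.
  by rewrite -mul2n exprM expr2 uu expr1n mulr1.
exact: mulIr.
Qed.

Lemma odd_units_char2 : 1 + 1 = 0 :> A.
Proof.
apply/eqP; rewrite addr_eq0 eq_sym; apply/eqP/odd_units_involution.
by rewrite mulrNN mulr1.
Qed.

Lemma odd_units_reduced (x : A) : x * x = 0 -> x = 0.
Proof.
move=> xx; apply: (addrI (1 : A)); rewrite addr0; apply: odd_units_involution.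
rewrite mulrDl !mulrDr !mul1r mulr1 xx addr0 -addrA.
by rewrite (char2_addrr odd_units_char2) addr0.
Qed.

(** The subring of sums of units has the same units as A, since it contains
every unit together with its inverse. *)
Lemma odd_units_mersenne : mersenne_products (size s).
Proof.
have sM : {in s &, forall u v : A, u * v \in s}.
  by move=> u v; rewrite !s_units unitrM => -> ->.
have s1 : 1 \in s by rewrite s_units; apply: unitr1.
have closed := subset_sums_subring odd_units_char2 s1 sM.
pose R : finComNzRingType := finite_subring closed.
have val_s (x : A) : x \in s -> exists y : R, val y = x.
  by move=> /sub_subset_sums xs; exists (SeqSub xs).
have -> : size s = #|corner_units (1 : R)|.
  rewrite cardE -(size_map val); apply/perm_size/uniq_perm => //.
    by rewrite map_inj_uniq ?enum_uniq //; apply: val_inj.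
  move=> x; apply/idP/mapP => [xs|[y + ->]].
    have x_unit : x \is a GRing.unit by rewrite -s_units.
    have [y yx] := val_s _ xs; exists y => //; rewrite mem_enum.
    apply/corner_unitsP; split; first exact: mul1r.
    have [|z zx] := val_s x^-1; first by rewrite s_units unitrV.
    by exists z; apply: val_inj; rewrite -[RHS](mulrV x_unit) -zx -yx.
  rewrite mem_enum => /corner_unitsP[_ [z yz]].
  rewrite s_units; apply/unitrPr; exists (val z).
  by rewrite -rmorphM yz rmorph1.
apply: card_corner_units_mersenne; last exact: mulr1.
  by apply: val_inj; rewrite rmorphD rmorph1 rmorph0 odd_units_char2.
move=> x xx; apply: val_inj; rewrite rmorph0; apply: odd_units_reduced.
by rewrite -rmorphM xx rmorph0.
Qed.

End OddUnits.

Theorem corollary5p5 :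
  unit_group_cardinals = even_positive `|` mersenne_products.
Proof.
apply/seteqP; split=> n.
  move=> [A /has_n_unitsP[s [s_uniq <- s_units]]].
  have [s_odd|s_even] := boolP (odd (size s)).
    by right; apply: odd_units_mersenne s_uniq s_odd s_units.
  left; split=> //; rewrite lt0n size_eq0; apply/eqP => s_nil.
  by have := s_units 1; rewrite s_nil unitr1.
by case=> [[]|]; [apply: even_unit_group_cardinal
                 |apply: mersenne_unit_group_cardinal].
Qed.
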